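(* Let $\alpha>0$, $\beta>0$, $n\ge0$ an integer. For real $\lambda\neq0$, the auxiliary variables $r_n(\lambda)$ and $R_n(\lambda)$ satisfy the coupled Riccati equations (with $'=d/d\lambda$) $$\lambda R_n'=-\alpha\lambda+R_n(2n+1+\alpha+\beta+\lambda)-R_n^2+2\lambda r_n,$$ $$r_n'=\frac{R_n}{\lambda R_n-\lambda^2}\left[n(n+\beta)+(2n+\alpha+\beta)r_n+\frac{\lambda}{R_n}(r_n^2-\alpha r_n)\right]+\frac{r_n^2-\alpha r_n}{R_n}.$$
   Context: $w(x)=x^{\alpha}(1-x)^{\beta}e^{-\lambda x}$ on $[0,1]$; $P_n$ is the monic orthogonal polynomial of degree $n$ for $w$ on $[0,1]$ (depending on $\lambda$), and $h_n=\int_0^1P_n^2w\,dx$. The auxiliary quantities are $$R_n(\lambda)=\frac{\alpha}{h_n}\int_0^1\frac{P_n^2(y)}{y}w(y)\,dy,\qquad r_n(\lambda)=\frac{\alpha}{h_{n-1}}\int_0^1\frac{P_n(y)P_{n-1}(y)}{y}w(y)\,dy\ (n\ge1),\qquad r_0:=0.$$ *)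

(* Defs.v *)
From HB Require Import structures.
From mathcomp Require Import all_boot all_order all_algebra.
From mathcomp Require Import all_classical all_reals all_analysis.

Set Implicit Arguments.
Unset Strict Implicit.
Unset Printing Implicit Defensive.

Import Order.TTheory GRing.Theory Num.Theory.
Import numFieldNormedType.Exports.

Local Open Scope ring_scope.
Local Open Scope classical_set_scope.

(* Since 0 `^ a = 0 for a != 0, the values at the endpoints are the usual ones
   when alpha and beta are positive. *)
Definition weight (R : realType) (alpha beta lambda x : R) : R :=
  x `^ alpha * (1 - x) `^ beta * expR (- (lambda * x)).

Definition wint (R : realType) (alpha beta lambda : R) (f : R -> R) : R :=
  \int[@lebesgue_measure R]_(x in `[0, 1]) (f x * weight alpha beta lambda x).

Definition monic_orthogonal (R : realType) (alpha beta lambda : R)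
    (P : nat -> {poly R}) : Prop :=
  (forall n, P n \is monic /\ size (P n) = n.+1) /\
  (forall m n, m != n ->
    wint alpha beta lambda (fun x => (P m).[x] * (P n).[x]) = 0).

Definition sqnorm (R : realType) (alpha beta lambda : R)
    (P : nat -> {poly R}) (n : nat) : R :=
  wint alpha beta lambda (fun x => (P n).[x] ^+ 2).

(* In the next two definitions P is a family of sequences indexed by the
   parameter lambda.  For 0 < alpha < 1 the integrand is unbounded near 0; the
   Lebesgue integral still converges, and the junk value 0^-1 = 0 at y = 0
   is irrelevant. *)
Definition aux_R (R : realType) (alpha beta : R) (P : R -> nat -> {poly R})
    (n : nat) (lambda : R) : R :=
  alpha / sqnorm alpha beta lambda (P lambda) n *
  wint alpha beta lambda (fun y => (P lambda n).[y] ^+ 2 / y).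

Definition aux_r (R : realType) (alpha beta : R) (P : R -> nat -> {poly R})
    (n : nat) (lambda : R) : R :=
  match n with
  | 0%N => 0
  | m.+1 =>
      alpha / sqnorm alpha beta lambda (P lambda) m *
      wint alpha beta lambda
        (fun y => (P lambda m.+1).[y] * (P lambda m).[y] / y)
  end.

(* Main.v *)
(** Write [M p] for the integral of [p w / (x (1 - x))] over [[0, 1]]; then
    [M (x (1 - x) p)], [M ((1 - x) p)] and [M (x p)] are the integrals of [p w],
    [p w / x] and [p w / (1 - x)].  Four facts about [M] suffice: it is linear,
    it is positive, it satisfies the Pearson identity obtained by integrating
    the derivative of [p w], and its derivative in [lambda] maps [p] to [- M (x p)].

    With [S_n := beta / h_n * M (x P_n^2)], the Pearson identity at [P_n^2]
    gives [S_n = R_n - lambda], so [R_n > max 0 lambda] and, as [lambda <> 0],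
    no division in the statement is by zero; at [P_(n+1) P_n] it gives
    [beta / h_n * M (x P_(n+1) P_n) = n + 1 + r_(n+1)], and at [x P_n^2] it
    expresses the recurrence coefficient [a_n] as
    [lambda a_n = 2 n + 1 + alpha + beta + lambda - R_n].  Evaluating at the
    endpoints 0 and 1 gives, with [b = h_(n+1) / h_n],
    [r_(n+1) (r_(n+1) - alpha) = b R_(n+1) R_n] and
    [(n + 1 + r_(n+1)) (n + 1 + r_(n+1) + beta) = b S_(n+1) S_n].

    Differentiating the orthogonality relations yields
    [dP_n/dlambda = x P_n - P_(n+1) - a_n P_n] and [dh_n/dlambda = - a_n h_n],
    hence [R_n' = 2 r_n - alpha + a_n R_n] and [r_(n+1)' = b (R_n - R_(n+1))],
    and the Riccati equations follow by eliminating [a_n], [b] and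
    the neighbouring [R_(n-1)]. *)
Require Import Defs.
From HB Require Import structures.
From mathcomp Require Import all_boot all_order all_algebra.
From mathcomp Require Import all_classical all_reals all_analysis.
From mathcomp Require Import measurable_realfun.
From mathcomp Require Import ring lra.

Set Implicit Arguments.
Unset Strict Implicit.
Unset Printing Implicit Defensive.

Import Order.TTheory GRing.Theory Num.Theory.
Import numFieldNormedType.Exports.

Local Open Scope ring_scope.

(** * Orthogonal polynomials at a fixed parameter *)

Definition pos_functional (R : realFieldType) (M : {poly R} -> R) : Prop :=
  forall p, p != 0 -> (forall x, 0 <= x <= 1 -> 0 <= p.[x]) -> 0 < M p.

(** With w' / w = alpha / x - beta / (1 - x) - lambda, the four terms are those of the integral of
    (p w)'. The density of [M] carries 1 / (x (1 - x)), so every pole becomes a polynomial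
    factor. *)
Definition pearson (R : realFieldType) (alpha beta lambda : R)
    (M : {poly R} -> R) : Prop :=
  forall p, M ('X * (1 - 'X) * p^`()) + alpha * M ((1 - 'X) * p)
    - beta * M ('X * p) - lambda * M ('X * (1 - 'X) * p) = 0.

Record orthogonal_system (R : realFieldType) (M : {poly R} -> R)
    (P : nat -> {poly R}) : Prop := OrthogonalSystem {
  functional_gt0 : pos_functional M;
  ops_monic : forall n, P n \is monic;
  ops_size : forall n, size (P n) = n.+1;
  ops_orth : forall m n, m != n -> M ('X * (1 - 'X) * (P m * P n)) = 0 }.

Section FixedParameter.
Variables (R : realFieldType) (M : {scalar {poly R}}).
Variable P : nat -> {poly R}.

Local Notation L p := (M ('X * (1 - 'X) * p)).
Local Notation L0 p := (M ((1 - 'X) * p)).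
Local Notation L1 p := (M ('X * p)).

Hypothesis ops : orthogonal_system M P.

Let M_pos := functional_gt0 ops.
Let P_monic := ops_monic ops.
Let size_P := ops_size ops.
Let P_orth := ops_orth ops.

Lemma ops_lead n : (P n)`_n = 1.
Proof. by have := monicP (P_monic n); rewrite lead_coefE size_P. Qed.

Lemma size_sub_ops_lead n (q : {poly R}) : (size q <= n.+1)%N ->
  (size (q - q`_n *: P n)%R <= n)%N.
Proof.
move=> sq; apply/leq_sizeP => j.
rewrite leq_eqVlt coefB coefZ => /predU1P[<-|nj].
  by rewrite ops_lead mulr1 subrr.
rewrite [q`_j]nth_default ?(leq_trans sq)//.
by rewrite [(P n)`_j]nth_default ?size_P// mulr0 subrr.
Qed.

(** The first n of the [P m] span the polynomials of size at most n: removing the top multiple of a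
    [P n] lowers the size. *)
Lemma scalar_span_eq0 (phi : {scalar {poly R}}) n :
  (forall m, (m < n)%N -> phi (P m) = 0) ->
  forall q : {poly R}, (size q <= n)%N -> phi q = 0.
Proof.
elim: n => [|n IH] phiP q sq.
  by move: sq; rewrite leqn0 size_poly_eq0 => /eqP ->; rewrite linear0.
rewrite -[q](subrKC (q`_n *: P n)) linearD [phi (_ *: _)]scalarZ phiP//.
rewrite mulr0 add0r; apply: IH; last exact: size_sub_ops_lead.
by move=> m mn; apply: phiP; apply: ltnW.
Qed.

Lemma functional_mull_scalar (f : {poly R}) : scalar (fun q => M (f * q)).
Proof. by move=> a p q /=; rewrite mulrDr -scalerAr linearD scalarZ. Qed.

(** Bundled as a linear form so that [scalar_span_eq0] applies to pairings with a fixed factor. *)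
Definition functional_mull (f : {poly R}) (q : {poly R}) := M (f * q).
HB.instance Definition _ f := GRing.isLinear.Build R {poly R} R *%R
  (functional_mull f) (functional_mull_scalar f).

Lemma ops_orth_lower n (q : {poly R}) : (size q <= n)%N -> L (P n * q) = 0.
Proof.
rewrite mulrA; apply: (scalar_span_eq0 (phi := functional_mull _)) => m mn.
by rewrite /= /functional_mull -(mulrA _ (P n)) P_orth// gtn_eqF.
Qed.

Lemma functional_sqr_gt0 (f : {poly R}) : f != 0 -> 0 < L (f ^+ 2).
Proof.
move=> f0; apply: M_pos => [|x /andP[x0 x1]].
  by rewrite !mulf_neq0 ?expf_neq0 ?polyX_eq0// -oppr_eq0 opprB polyXsubC_eq0.
rewrite !hornerE /= -mulrA -expr2; apply: mulr_ge0 _ (sqr_ge0 _).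
by rewrite ?mulr_ge0 ?subr_ge0.
Qed.

(** [E] is itself a combination of these [P m], so L (E^2) = 0, which positivity forbids unless [E]
    is zero. *)
Lemma ops_orth_eq0 (E : {poly R}) n : (size E <= n)%N ->
  (forall m, (m < n)%N -> L (E * P m) = 0) -> E = 0.
Proof.
move=> sE EP; apply/eqP/negP => /negP /functional_sqr_gt0.
rewrite expr2 mulrA -/(functional_mull _ E).
rewrite (scalar_span_eq0 (phi := functional_mull _) (n := n))//.
  by rewrite ltxx.
by move=> m /EP; rewrite mulrA.
Qed.

Let h n := L (P n ^+ 2).

Lemma sqnorm_gt0 n : 0 < h n.
Proof. by apply: functional_sqr_gt0; rewrite monic_neq0. Qed.

Lemma sqnorm_neq0 n : h n != 0.
Proof. by rewrite gt_eqF ?sqnorm_gt0. Qed.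

Lemma ops_mul_lead n (q : {poly R}) : (size q <= n.+1)%N ->
  L (P n * q) = q`_n * h n.
Proof.
move=> sq; rewrite mulrA -[in LHS](subrKC (q`_n *: P n) q).
rewrite functional_mull_scalar -!(mulrA _ (P n)) -expr2 -/(h n).
by rewrite ops_orth_lower ?addr0//; exact: size_sub_ops_lead.
Qed.

(** Used at c = 0 and c = 1, where ['X - c%:P] cancels the pole of w / x or w / (1 - x). The leading
    coefficient passes to [q1], ready for [ops_mul_lead]. *)
Lemma taylor1 (c : R) (n : nat) (q : {poly R}) : (size q <= n.+2)%N ->
  exists q1, [/\ q = q.[c]%:P + ('X - c%:P) * q1, (size q1 <= n.+1)%N
    & q1`_n = q`_n.+1].
Proof.
move=> sq; have /factor_theorem[q1 eq1] : root (q - q.[c]%:P) c.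
  by rewrite /root !hornerE subrr.
have eq : q = q.[c]%:P + ('X - c%:P) * q1 by rewrite mulrC -eq1 addrC subrK.
have sq1 : (size q1 <= n.+1)%N.
  have [->|q10] := eqVneq q1 0; first by rewrite size_poly0.
  rewrite -ltnS -addn1.
  have := size_Mmonic q10 (monicXsubC c).
  rewrite size_XsubC addn2 addn1 /= => <-.
  rewrite -eq1 (leq_trans (size_polyD _ _))// geq_max sq size_polyN.
  by rewrite (leq_trans (size_polyC_leq1 _)).
exists q1; split => //.
rewrite [in RHS]eq mulrBl coefD coefB coefXM coefCM coefC /=.
by rewrite [q1`_n.+1]nth_default// mulr0 subr0 add0r.
Qed.

Lemma functional_onemX_ops n (q : {poly R}) : (size q <= n.+2)%N ->
  L0 (P n * q) = q.[0] * L0 (P n) + q`_n.+1 * h n.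
Proof.
move=> /(taylor1 0)[q1 [eq sq1 <-]]; rewrite -ops_mul_lead//.
rewrite -scalarZ -linearD [in LHS]eq -mul_polyC polyC0; congr (M _).
ring.
Qed.

(** The remainder carries ['X * ('X - 1)], the opposite of ['X * (1 - 'X)], hence the minus sign. *)
Lemma functional_X_ops n (q : {poly R}) : (size q <= n.+2)%N ->
  L1 (P n * q) = q.[1] * L1 (P n) - q`_n.+1 * h n.
Proof.
move=> /(taylor1 1)[q1 [eq sq1 <-]]; rewrite -ops_mul_lead//.
rewrite -scalarZ -linearB [in LHS]eq -mul_polyC polyC1; congr (M _).
ring.
Qed.

(** * Endpoint evaluations and the Pearson identity *)

Variables alpha beta lambda : R.
Hypothesis alpha_gt0 : 0 < alpha.
Hypothesis beta_gt0 : 0 < beta.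
Hypothesis M_pearson : pearson alpha beta lambda M.

Let rR n := alpha / h n * L0 (P n ^+ 2).
Let rr n := alpha / h n * L0 (P n.+1 * P n).
Let ra n := L ('X * P n ^+ 2) / h n.

Let a n := (P n).[0].
Let b n := (P n).[1].
Let u n := L0 (P n).
Let v n := L1 (P n).

Let L0_sqr n : L0 (P n ^+ 2) = a n * u n.
Proof.
rewrite expr2 functional_onemX_ops ?size_P// nth_default ?size_P//.
by rewrite mul0r addr0.
Qed.

Let L1_sqr n : L1 (P n ^+ 2) = b n * v n.
Proof.
by rewrite expr2 functional_X_ops ?size_P// nth_default ?size_P// mul0r subr0.
Qed.

(** One integral is computed twice, here and in [L0_crossS], by expanding [P n] or [P n.+1] at 0.
    Only the second expansion meets a leading coefficient, hence its extra [h n]. *)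
Let L0_cross n : L0 (P n.+1 * P n) = a n * u n.+1.
Proof.
have sP : (size (P n) <= n.+2)%N by rewrite size_P leqW.
by rewrite functional_onemX_ops 1?leqW// [(P n)`_n.+2]nth_default// mul0r addr0.
Qed.

Let L0_crossS n : L0 (P n.+1 * P n) = a n.+1 * u n + h n.
Proof.
by rewrite (mulrC (P n.+1)) functional_onemX_ops ?size_P// ops_lead mul1r.
Qed.

Let L1_cross n : L1 (P n.+1 * P n) = b n * v n.+1.
Proof.
have sP : (size (P n) <= n.+2)%N by rewrite size_P leqW.
by rewrite functional_X_ops 1?leqW// [(P n)`_n.+2]nth_default// mul0r subr0.
Qed.

Let L1_crossS n : L1 (P n.+1 * P n) = b n.+1 * v n - h n.
Proof.
by rewrite (mulrC (P n.+1)) functional_X_ops ?size_P// ops_lead mul1r.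
Qed.

Lemma functional_onemX_sqr_gt0 (f : {poly R}) : f != 0 -> 0 < L0 (f ^+ 2).
Proof.
move=> f0; apply: M_pos => [|x /andP[x0 x1]].
  by rewrite mulf_neq0 ?expf_neq0// -oppr_eq0 opprB polyXsubC_eq0.
rewrite !hornerE /= -mulrA -expr2; apply: mulr_ge0 _ (sqr_ge0 _).
by rewrite ?mulr_ge0 ?subr_ge0.
Qed.

Lemma functional_X_sqr_gt0 (f : {poly R}) : f != 0 -> 0 < L1 (f ^+ 2).
Proof.
move=> f0; apply: M_pos => [|x /andP[x0 x1]].
  by rewrite mulf_neq0 ?expf_neq0 ?polyX_eq0.
rewrite !hornerE /= -mulrA -expr2; apply: mulr_ge0 _ (sqr_ge0 _).
by rewrite ?mulr_ge0 ?subr_ge0.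
Qed.

Lemma auxR_gt0 n : 0 < rR n.
Proof.
by rewrite mulr_gt0 ?divr_gt0 ?sqnorm_gt0 ?functional_onemX_sqr_gt0 ?monic_neq0.
Qed.

Let size_derivP n : (size (P n)^`() <= n)%N.
Proof. by rewrite -ltnS -(size_P n) lt_size_deriv// monic_neq0. Qed.

Lemma auxR_subE n : rR n - lambda = beta / h n * L1 (P n ^+ 2).
Proof.
have hn := sqnorm_neq0 n; have := M_pearson (P n ^+ 2).
have -> : L (P n ^+ 2)^`() = L (P n * (P n)^`()) + L (P n * (P n)^`()).
  by rewrite -linearD expr2 derivM; congr (M _); ring.
(* The derivative term is 2 L (P_n P_n'), zero because P_n' has degree below n. *)
rewrite ops_orth_lower// -/(h n) !add0r => /eqP; rewrite subr_eq0 => /eqP E.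
by apply: (mulIf hn); rewrite mulrBl -E /rR; field.
Qed.

Lemma auxR_gt n : lambda < rR n.
Proof.
rewrite -subr_gt0 auxR_subE.
by rewrite mulr_gt0 ?divr_gt0 ?sqnorm_gt0 ?functional_X_sqr_gt0 ?monic_neq0.
Qed.

(** By the two evaluations at 0, [rr n] is a multiple of [a n * u n.+1] and [rr n - alpha] of
    [a n.+1 * u n]. Their product regroups into the square integrals behind [rR n] and [rR n.+1]. *)
Lemma auxrM n : rr n * (rr n - alpha) = h n.+1 / h n * rR n.+1 * rR n.
Proof.
have hn := sqnorm_neq0 n; have hn1 := sqnorm_neq0 n.+1.
have -> : rr n - alpha = alpha / h n * (a n.+1 * u n).
  by rewrite /rr L0_crossS; field.
by rewrite /rr /rR L0_cross !L0_sqr; field; rewrite hn hn1.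
Qed.

Lemma auxr_addE n : n.+1%:R + rr n = beta / h n * L1 (P n.+1 * P n).
Proof.
have hn := sqnorm_neq0 n.
have := M_pearson (P n.+1 * P n).
(* Of the two product-rule terms only P_n P_(n+1)' survives, and P_(n+1)' has leading coefficient n
   + 1. *)
have -> : L (P n.+1 * P n)^`() = n.+1%:R * h n.
  transitivity (L (P n * (P n.+1)^`()) + L (P n.+1 * (P n)^`())).
    by rewrite -linearD derivM; congr (M _); ring.
  rewrite ops_mul_lead// ops_orth_lower ?addr0 ?coef_deriv ?ops_lead//.
  by rewrite (leq_trans (size_derivP n)).
rewrite P_orth ?gtn_eqF// mulr0 subr0 => /eqP; rewrite subr_eq0 => /eqP E.
by rewrite mulrAC -E /rr; field.
Qed.

Lemma auxr_addM n : (n.+1%:R + rr n) * (n.+1%:R + rr n + beta) =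
  h n.+1 / h n * (rR n.+1 - lambda) * (rR n - lambda).
Proof.
have hn := sqnorm_neq0 n; have hn1 := sqnorm_neq0 n.+1.
have E : n.+1%:R + rr n + beta = beta / h n * (b n.+1 * v n).
  by rewrite auxr_addE L1_crossS; field.
by rewrite E auxr_addE L1_cross !auxR_subE !L1_sqr; field; rewrite hn hn1.
Qed.

Lemma lambda_recur n :
  lambda * ra n = 2 * n%:R + 1 + alpha + beta + lambda - rR n.
Proof.
have hn := sqnorm_neq0 n.
have := M_pearson ('X * P n ^+ 2).
have -> : L ('X * P n ^+ 2)^`() = (2 * n%:R + 1) * h n.
  transitivity (L (P n ^+ 2) + (2 * L (P n * ('X * (P n)^`())))).
    rewrite mulr2n mulrDl !mul1r -!linearD expr2 !derivM derivX; congr (M _).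
    ring.
  rewrite ops_mul_lead; last first.
    apply/leq_sizeP => -[//|j] nj; rewrite coefXM /= nth_default//.
    exact: leq_trans (size_derivP n) _.
  (* The case n = 0 is separate because multiplication by X shifts the index; both sides are then
     0. *)
  have -> : ('X * (P n)^`())`_n = n%:R.
    by case: (n) => [|m]; rewrite coefXM//= coef_deriv ops_lead.
  by rewrite -/(h n); ring.
have -> : L0 ('X * P n ^+ 2) = h n by congr (M _); ring.
have -> : L1 ('X * P n ^+ 2) = L1 (P n ^+ 2) - h n.
  by rewrite -linearB; congr (M _); ring.
move=> E; apply: (mulIf hn).
have -> : lambda * ra n * h n = lambda * L ('X * P n ^+ 2).
  by rewrite /ra; field.
have H1 : beta * L1 (P n ^+ 2) = (rR n - lambda) * h n.
  by rewrite auxR_subE; field.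
by move/eqP: E; rewrite subr_eq0 => /eqP <-; rewrite mulrBr H1; ring.
Qed.

(** * Three-term recurrence *)

Lemma recurE n : L (P n * ('X * P n)) = ra n * h n.
Proof.
have hn := sqnorm_neq0 n; rewrite /ra mulfVK//.
by congr (M _); ring.
Qed.

Let size_recl n (D : {poly R}) : (size D <= n)%N ->
  (size (D - ('X * P n - P n.+1 - ra n *: P n))%R <= n.+1)%N.
Proof.
move=> sD; rewrite (leq_trans (size_polyD _ _))// geq_max leqW//= size_polyN.
rewrite (leq_trans (size_polyD _ _))// geq_max size_polyN.
rewrite (leq_trans (size_scale_leq _ _)) ?size_P// andbT.
have := @size_sub_ops_lead n.+1 ('X * P n).
rewrite coefXM /= ops_lead scale1r; apply.
by rewrite mulrC size_mulX ?monic_neq0// size_P.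
Qed.

(** The difference of the two sides has degree at most n, since X P_n and P_(n+1) are both monic,
    and is orthogonal to P_0, ..., P_n; [ra n] settles the last of these. This identifies both the
    lambda-derivative of P_n and the lower term of the recurrence. *)
Lemma ops_shift_unique n (D : {poly R}) : (size D <= n)%N ->
  (forall m, (m < n)%N -> L (D * P m) = L ('X * P n * P m)) ->
  D = 'X * P n - P n.+1 - ra n *: P n.
Proof.
move=> sD DP; apply/eqP; rewrite -subr_eq0; apply/eqP.
apply: (ops_orth_eq0 (size_recl sD)) => m.
have -> : L ((D - ('X * P n - P n.+1 - ra n *: P n)) * P m) =
    L (D * P m) - L ('X * P n * P m) + L (P n.+1 * P m) + ra n * L (P n * P m).
  rewrite -(scalarZ M) -linearB -!linearD -!mul_polyC; congr (M _); ring.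
rewrite ltnS leq_eqVlt => /predU1P[->|mn].
  have -> : L (D * P n) = 0 by rewrite (mulrC D) ops_orth_lower.
  have -> : L ('X * P n * P n) = ra n * h n.
    by rewrite -recurE; congr (M _); ring.
  have -> : L (P n.+1 * P n) = 0 by rewrite P_orth// gtn_eqF.
  by rewrite -expr2 -/(h n); ring.
have -> : L (P n.+1 * P m) = 0 by rewrite P_orth// gtn_eqF// ltnW.
have -> : L (P n * P m) = 0 by rewrite P_orth// gtn_eqF.
by rewrite DP//; ring.
Qed.

Lemma ops_three_term n :
  'X * P n.+1 - P n.+2 - ra n.+1 *: P n.+1 = (h n.+1 / h n) *: P n.
Proof.
have hn := sqnorm_neq0 n.
apply/esym/ops_shift_unique => [|m].
  by rewrite (leq_trans (size_scale_leq _ _)) ?size_P.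
have -> : L ((h n.+1 / h n) *: P n * P m) = h n.+1 / h n * L (P n * P m).
  rewrite -(scalarZ M) -!mul_polyC; congr (M _); ring.
have -> : L ('X * P n.+1 * P m) = L (P n.+1 * ('X * P m)).
  congr (M _); ring.
rewrite ltnS leq_eqVlt => /predU1P[->|mn].
  (* For m = n, X P_n is monic of degree n + 1, so its pairing with P_(n+1) is h_(n+1). *)
  rewrite -expr2 -/(h n) divfK// [RHS]ops_mul_lead ?coefXM ?ops_lead ?mul1r//.
  by rewrite mulrC size_mulX ?monic_neq0// size_P.
rewrite P_orth ?gtn_eqF// mulr0 [RHS]ops_orth_lower//.
by rewrite mulrC size_mulX ?monic_neq0// size_P.
Qed.

End FixedParameter.

Local Open Scope classical_set_scope.

(** * Dependence on the parameter *)

Section ParameterDerivative.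
Variables (R : realType).

(** The degree bound, uniform in [t], makes [M t (F t)] a sum of a fixed number
    of products of derivable functions. *)
Definition is_polyderive (l : R) (F : R -> {poly R}) (D : {poly R}) : Prop :=
  (exists N, forall t, (size (F t) <= N)%N) /\
  forall k, is_derive l 1 (fun t => (F t)`_k) D`_k.

Lemma is_polyderive_cst (l : R) (p : {poly R}) :
  is_polyderive l (fun=> p) 0.
Proof.
split; first by exists (size p).
by move=> k; rewrite coef0; exact: is_derive_cst.
Qed.

Lemma is_polyderiveC (l : R) (c : R -> R) (dc : R) : is_derive l 1 c dc ->
  is_polyderive l (fun t => (c t)%:P) dc%:P.
Proof.
move=> dcl; split; first by exists 1%N => t; exact: size_polyC_leq1.
move=> [|k]; rewrite coefC /=.
  by under eq_fun do rewrite coefC /=.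
by under eq_fun do rewrite coefC /=; exact: is_derive_cst.
Qed.

Lemma is_polyderiveB (l : R) F G D E :
  is_polyderive l F D -> is_polyderive l G E ->
  is_polyderive l (fun t => F t - G t) (D - E).
Proof.
move=> [[N sF] dF] [[N' sG] dG]; split.
  exists (maxn N N') => t; rewrite (leq_trans (size_polyD _ _))// size_polyN.
  by rewrite geq_max !leq_max sF sG orbT.
move=> k; rewrite coefB; under eq_fun do rewrite coefB.
exact: (is_deriveB (dF k) (dG k)).
Qed.

Lemma is_polyderiveM (l : R) F G D E :
  is_polyderive l F D -> is_polyderive l G E ->
  is_polyderive l (fun t => F t * G t) (D * G l + F l * E).
Proof.
move=> [[N sF] dF] [[N' sG] dG]; split.
  exists (N + N')%N => t; rewrite (leq_trans (size_polyMleq _ _))//.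
  by rewrite (leq_trans (leq_pred _))// leq_add.
move=> k; rewrite coefD !coefM; under eq_fun do rewrite coefM.
rewrite -big_split /=.
have := @is_derive_sum _ _ _ k.+1 (fun j t => (F t)`_j * (G t)`_(k - j)) l 1
  (fun j => D`_j * (G l)`_(k - j) + (F l)`_j * E`_(k - j)).
rewrite fct_sumE; apply => j.
apply: (is_derive_eq (is_deriveM (dF j) (dG (k - j)%N))).
by rewrite /GRing.scale /= addrC mulrC.
Qed.

Lemma size_is_polyderive (l : R) (F : R -> {poly R}) D N :
  (forall t, (size (F t) <= N)%N) -> is_polyderive l F D -> (size D <= N)%N.
Proof.
move=> sF [_ dF]; apply/leq_sizeP => k Nk.
have /@derive_val <- := dF k.
suff -> : (fun t => (F t)`_k) = cst 0 by rewrite derive_cst.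
by apply/funext => t; rewrite nth_default// (leq_trans (sF t)).
Qed.

Variable M : R -> {scalar {poly R}}.
Hypothesis dM : forall (l : R) (p : {poly R}),
  is_derive l 1 (fun t => M t p) (- M l ('X * p)).

Lemma is_derive_functional (l : R) F D : is_polyderive l F D ->
  is_derive l 1 (fun t => M t (F t)) (M l D - M l ('X * F l)).
Proof.
move=> dF; have [[N sF] dFk] := dF; have sD := size_is_polyderive sF dF.
have polyE (p : {poly R}) : (size p <= N)%N -> p = \poly_(k < N) p`_k.
  move=> sp; apply/polyP => k; rewrite coef_poly.
  by case: ltnP => // /(leq_trans sp)/(nth_default 0).
have ME t (p : {poly R}) : (size p <= N)%N ->
    M t p = \sum_(k < N) p`_k * M t 'X^k.
  move=> sp; rewrite {1}(polyE _ sp) poly_def linear_sum.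
  by apply: eq_bigr => k _; rewrite scalarZ.
have -> : (fun t => M t (F t)) = \sum_(k < N) (fun t => (F t)`_k * M t 'X^k).
  by apply/funext => t; rewrite fct_sumE ME.
have -> : M l D - M l ('X * F l) =
    \sum_(k < N) (D`_k * M l 'X^k + (F l)`_k * - M l ('X * 'X^k)).
  rewrite big_split /= -ME//; congr (_ + _).
  rewrite [X in 'X * X](polyE _ (sF l)) poly_def mulr_sumr linear_sum -sumrN.
  apply: eq_bigr => k _.
  by rewrite -scalerAr scalarZ mulrN.
apply: is_derive_sum => k.
apply: (is_derive_eq (is_deriveM (dFk k) (dM l 'X^k))).
by rewrite /GRing.scale /= addrC (mulrC (M l 'X^k)).
Qed.

Variable P : R -> nat -> {poly R}.
Hypothesis ops : forall l, orthogonal_system (M l) (P l).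

Let size_P l := ops_size (ops l).

Local Notation L l p := (M l ('X * (1 - 'X) * p)).
Local Notation L0 l p := (M l ((1 - 'X) * p)).

Let h l n := L l (P l n ^+ 2).
Let ra l n := L l ('X * P l n ^+ 2) / h l n.

Let h_neq0 l n : h l n != 0.
Proof. exact: sqnorm_neq0. Qed.

Variable alpha : R.
Let rR l n := alpha / h l n * L0 l (P l n ^+ 2).
Let rr l n := alpha / h l n * L0 l (P l n.+1 * P l n).

Lemma is_derive_div (l : R) (f g : R -> R) df dg : g l != 0 ->
  is_derive l 1 f df -> is_derive l 1 g dg ->
  is_derive l 1 (fun t => f t / g t) (df / g l - f l * dg / g l ^+ 2).
Proof.
move=> gl dfl dgl; have dgV := is_deriveV gl dgl.
apply: (is_derive_eq (is_deriveM dfl dgV)).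
by rewrite /GRing.scale /=; field.
Qed.

Lemma is_derive_cst_div (l c : R) (f g : R -> R) df dg : g l != 0 ->
  is_derive l 1 f df -> is_derive l 1 g dg ->
  is_derive l 1 (fun t => c / g t * f t)
    (c / g l * df - c * f l * dg / g l ^+ 2).
Proof.
move=> gl dfl dgl; have d := is_deriveZ c (is_derive_div gl dfl dgl).
rewrite (_ : (fun t => _) = c \*: (fun t => f t / g t)); last first.
  by apply/funext => t; rewrite mulrAC -mulrA.
by apply: (is_derive_eq d); rewrite /GRing.scale /=; field.
Qed.

Let is_derive_L (l : R) (F : R -> {poly R}) D : is_polyderive l F D ->
  is_derive l 1 (fun t => L t (F t)) (L l D - L l ('X * F l)).
Proof.
move=> dF.
have := is_derive_functional
  (is_polyderiveM (is_polyderive_cst l ('X * (1 - 'X))) dF).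
move/is_derive_eq; apply.
by congr (M l _ - M l _); ring.
Qed.

Let is_derive_L0 (l : R) (F : R -> {poly R}) D : is_polyderive l F D ->
  is_derive l 1 (fun t => L0 t (F t)) (L0 l D - L l (F l)).
Proof.
move=> dF.
have := is_derive_functional
  (is_polyderiveM (is_polyderive_cst l (1 - 'X)) dF).
move/is_derive_eq; apply.
by congr (M l _ - M l _); ring.
Qed.

Let polyderive_step (l : R) n D : is_polyderive l (P^~ n) D ->
  exists D', is_polyderive l (fun t => 'X * P t n - ra t n *: P t n) D'.
Proof.
move=> dP; have dP2 := is_polyderiveM dP dP.
have dX := is_polyderiveM (is_polyderive_cst l 'X) dP.
have [d dra] : exists d, is_derive l 1 (ra^~ n) d.
  eexists; apply: is_derive_div => //; last exact: (is_derive_L dP2).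
  exact: (is_derive_L (is_polyderiveM (is_polyderive_cst l 'X) dP2)).
have := is_polyderiveB dX (is_polyderiveM (is_polyderiveC dra) dP).
by under eq_fun do rewrite mul_polyC; eexists; eassumption.
Qed.

(** No regularity in [t] is assumed of the family. It comes from the recurrence, which builds
    P_(n+2) from P_(n+1), P_n and quotients of their integrals; hence an induction on two
    consecutive indices. *)
Lemma ops_ex_polyderive (l : R) n : exists D, is_polyderive l (P^~ n) D.
Proof.
have P0 : exists D, is_polyderive l (P^~ 0%N) D.
  exists 0; rewrite (_ : P^~ 0%N = fun=> 1); first exact: is_polyderive_cst.
  apply/funext => t.
  have /size1_polyC eP : (size (P t 0) <= 1)%N by rewrite size_P.
  by rewrite eP (ops_lead (ops t)).
suff [] : (exists D, is_polyderive l (P^~ n) D) /\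
  (exists D, is_polyderive l (P^~ n.+1) D) by [].
elim: n => [|n [[D dD] [E dE]]]; split.
- exact: P0.
- have [D dD] := P0.
  have [D' dD'] := polyderive_step dD; exists D'.
  rewrite (_ : P^~ 1%N = fun t => 'X * P t 0 - ra t 0 *: P t 0)//.
  (* At index 0 with D = 0 the orthogonality condition is vacuous, which yields P_1 = X P_0 - a_0
     P_0. *)
  apply/funext => t; have := @ops_shift_unique _ (M t) (P t) (ops t) 0%N 0.
  rewrite size_poly0 => /(_ isT) E.
  apply/esym/eqP; rewrite -subr_eq0 addrAC; apply/eqP/esym.
  by apply: E.
- by exists E.
- have [d dh] : exists d, is_derive l 1 (fun t => h t n.+1 / h t n) d.
    eexists; apply: is_derive_div => //; apply: is_derive_L.
      exact: (is_polyderiveM dE dE).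
    exact: (is_polyderiveM dD dD).
  have [E' dE'] := polyderive_step dE.
  have d2 := is_polyderiveB dE' (is_polyderiveM (is_polyderiveC dh) dD).
  move: d2; set D2 := (E' - _) => d2; exists D2; move: d2; congr is_polyderive.
  apply/funext => t; rewrite mul_polyC.
  rewrite -(ops_three_term (ops t)).
  by rewrite -/(h t n.+1) -/(ra t n.+1); ring.
Qed.

(** * Derivatives of the polynomials, norms and auxiliary quantities *)

Section Derivatives.
Variables (l : R) (n : nat) (D : {poly R}).
Hypothesis dP : is_polyderive l (P^~ n) D.

(** Monicity freezes the coefficient of degree n, so its derivative is 0. *)
Lemma size_polyderive_ops : (size D <= n)%N.
Proof.
apply/leq_sizeP => j; rewrite leq_eqVlt => /predU1P[<-|nj].
  have /@derive_val <- := dP.2 n.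
  rewrite (_ : (fun t => _) = cst 1) ?derive_cst//.
  by apply/funext => t; rewrite (ops_lead (ops t)).
rewrite nth_default// (leq_trans _ nj)//.
by apply: size_is_polyderive dP => t; rewrite size_P.
Qed.

(** Differentiating L (P_n P_m) = 0 for m < n leaves L (D P_m) = L (X P_n P_m), since the derivative
    of P_m has too low a degree to pair with P_n. *)
Lemma ops_polyderiveE : D = 'X * P l n - P l n.+1 - ra l n *: P l n.
Proof.
apply: (ops_shift_unique (ops l) size_polyderive_ops) => m mn.
have [E dE] := ops_ex_polyderive l m.
have sE : (size E <= m.+1)%N.
  by apply: size_is_polyderive dE => t; rewrite size_P.
have := is_derive_L (is_polyderiveM dP dE).
have -> : (fun t => L t (P t n * P t m)) = cst 0.
  by apply/funext => t; rewrite (ops_orth (ops t))// gtn_eqF.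
move=> /@derive_val; rewrite derive_cst => /esym/eqP.
rewrite subr_eq0 => /eqP e.
transitivity (L l (D * P l m + P l n * E)).
  rewrite -[LHS]addr0 -(ops_orth_lower (ops l) (leq_trans sE mn)).
  by rewrite -linearD; congr (M l _); ring.
by rewrite e; congr (M l _); ring.
Qed.

Lemma is_derive_sqnorm : is_derive l 1 (h^~ n) (- (ra l n * h l n)).
Proof.
apply: (is_derive_eq (is_derive_L (is_polyderiveM dP dP))).
rewrite [X in X - _](_ : _ = L l (P l n * D) + L l (P l n * D)); last first.
  by rewrite -linearD; congr (M l _); ring.
rewrite (ops_orth_lower (ops l) size_polyderive_ops).
rewrite !add0r; congr (- _).
by rewrite -(recurE (ops l)); congr (M l _); ring.
Qed.

(** The factor x brought down by the exponential cancels 1 / x, so the weight contributes - alpha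
    h_n / h_n. Differentiating 1 / h_n contributes the [ra] term. *)
Lemma is_derive_auxR : is_derive l 1 (rR^~ n)
  (2 * (alpha / h l n * L0 l (P l n * D)) - alpha + ra l n * rR l n).
Proof.
have hn := h_neq0 l n.
have dR := is_derive_cst_div alpha hn (is_derive_L0 (is_polyderiveM dP dP))
  is_derive_sqnorm.
apply: (is_derive_eq dR).
have -> : L0 l (D * P l n + P l n * D) = 2 * L0 l (P l n * D).
  by rewrite mulr_natl mulr2n -linearD; congr (M l _); ring.
by rewrite -expr2 -/(h l n) /rR; field.
Qed.

End Derivatives.

Lemma is_derive_auxR0 (l : R) : is_derive l 1 (rR^~ 0%N)
  (- alpha + ra l 0 * rR l 0).
Proof.
have [D dD] := ops_ex_polyderive l 0.
have := size_polyderive_ops dD; rewrite leqn0 size_poly_eq0 => /eqP D0.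
apply: (is_derive_eq (is_derive_auxR dD)).
by rewrite D0 !mulr0 linear0; ring.
Qed.

Lemma ops_polyderiveS (l : R) n D : is_polyderive l (P^~ n.+1) D ->
  D = (h l n.+1 / h l n) *: P l n.
Proof. by move/ops_polyderiveE ->; rewrite (ops_three_term (ops l)). Qed.

Lemma is_derive_auxRS (l : R) n : is_derive l 1 (rR^~ n.+1)
  (2 * rr l n - alpha + ra l n.+1 * rR l n.+1).
Proof.
have [D dD] := ops_ex_polyderive l n.+1.
apply: (is_derive_eq (is_derive_auxR dD)).
rewrite (ops_polyderiveS dD); congr (_ * _ - _ + _).
have hn := h_neq0 l n; have hn1 := h_neq0 l n.+1.
rewrite -2!scalerAr scalarZ /rr; field.
by rewrite hn hn1.
Qed.

Lemma is_derive_auxr (l : R) n : is_derive l 1 (rr^~ n)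
  (h l n.+1 / h l n * (rR l n - rR l n.+1)).
Proof.
have [D dD] := ops_ex_polyderive l n; have [E dE] := ops_ex_polyderive l n.+1.
have hn := h_neq0 l n; have hn1 := h_neq0 l n.+1.
have dr := is_derive_cst_div alpha hn (is_derive_L0 (is_polyderiveM dE dD))
  (is_derive_sqnorm dD).
apply: (is_derive_eq dr).
rewrite (ops_polyderiveS dE) (ops_polyderiveE dD) (ops_orth (ops l)) ?gtn_eqF//.
rewrite subr0; set c := L0 l (P l n.+1 * P l n).
rewrite (_ : L0 l (_ + _) = h l n.+1 / h l n * L0 l (P l n ^+ 2)
    - L0 l (P l n.+1 ^+ 2) - ra l n * c); last first.
  (* The zero added is L (P_(n+1) P_n), what remains of the term X P_n of the derivative once X
     cancels 1 / x. *)
  rewrite -[RHS]addr0 -(ops_orth (ops l) (m := n.+1) (n := n)) ?gtn_eqF//.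
  rewrite -!scalarZ -!linearB -linearD -!mul_polyC; congr (M l _); ring.
rewrite /rR -/(h l n) -/(h l n.+1); field.
by rewrite hn hn1.
Qed.

End ParameterDerivative.

(** * Integrals with endpoint singularities *)

Section ImproperFTC.
Variables (R : realType) (F f : R -> R) (a b : R).
Hypothesis ab : a < b.
Hypothesis dF : forall x, x \in `]a, b[%R -> is_derive x 1 F (f x).
Hypothesis cf : {in `]a, b[%R, continuous f}.
Hypothesis cF : {within `[a, b], continuous F}.
Local Notation mu := (@lebesgue_measure R).

Let mf : measurable_fun `]a, b[ f.
Proof.
apply: open_continuous_measurable_fun; first exact: interval_open.
by move=> x; rewrite inE/=; exact: cf.
Qed.

(** [F] is nondecreasing, so the integrals over inner intervals are at most F b - F a. Monotone
    convergence carries this bound to the whole interval, even if [f] blows up at the ends. *)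
Lemma derive_ge0_integrable : (forall x, x \in `]a, b[%R -> 0 <= f x) ->
  mu.-integrable `[a, b] (EFin \o f).
Proof.
move=> f0; have mfab : measurable_fun `[a, b] f.
  by apply/measurable_fun_itv_bndo_bndcP; apply/measurable_fun_itv_obnd_cbndP.
(* Denominators start at 3 so that even the first [E n] is a nondegenerate interval. *)
pose e (n : nat) : R := (b - a) / n.+3%:R.
pose E n := `[a + e n, b - e n].
have e0 n : 0 < e n by rewrite divr_gt0 ?subr_gt0.
have eS n m : (n <= m)%N -> e m <= e n.
  by move=> nm; rewrite ler_pM2l ?subr_gt0// lef_pV2 ?posrE// ler_nat.
have e3 n : a + e n < b - e n.
  have : e n <= (b - a) / 3 := eS _ _ (leq0n n).
  by move: ab; lra.
have E_oo n : E n `<=` `]a, b[.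
  by apply: subset_itvSoo; rewrite bnd_simp ?ltrBlDr ltrDl.
have EU : \bigcup_n E n = `]a, b[.
  apply/seteqP; split; first exact: bigcup_sub.
  move=> x; rewrite /= in_itv /= => /andP[ax xb].
  pose m := Num.min (x - a) (b - x).
  have m0 : 0 < m by rewrite lt_min !subr_gt0 ax.
  have Nm : e (Num.bound ((b - a) / m)) <= m.
    rewrite /e ler_pdivrMr// mulrC -ler_pdivrMr//.
    have := archi_boundP (ltW (divr_gt0 (_ : 0 < b - a) m0)).
    rewrite subr_gt0 => /(_ ab)/ltW/le_trans; apply.
    by rewrite ler_nat -[leqRHS]addn3 leq_addr.
  exists (Num.bound ((b - a) / m)) => //; rewrite /E /= in_itv /=.
  by move: Nm; rewrite le_min => /andP[]; lra.
have mE n : measurable (E n) by exact: measurable_itv.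
have monoF : {in `[a, b]%R &, {homo F : x y / x <= y}}.
  apply: ger0_derive1_le_cc cF => x xab; first by have [] := dF xab.
  by rewrite derive1E (derive_val (is_derive := dF xab)) f0.
have intE n : (\int[mu]_(x in E n) (f x)%:E <= (F b - F a)%:E)%E.
  have sub x : x \in `]a + e n, b - e n[%R -> x \in `]a, b[%R.
    by move=> /subset_itv_oo_cc /E_oo.
  have cFn : {within E n, continuous F}.
    apply: continuous_subspaceW cF; apply: (subset_trans (@E_oo n)).
    exact: subset_itv_oo_cc.
  rewrite (continuous_FTC2 (F := F) (e3 n)).
  - have ea : a < a + e n by rewrite ltrDl.
    have eb : b - e n < b by rewrite ltrBlDr ltrDl.
    have := e3 n => eab.
    by rewrite -EFinB lee_fin lerB//; apply: monoF;
      rewrite ?in_itv/= ?lexx ?ltW//=; lra.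
  - apply: continuous_in_subspaceT => x /set_mem /E_oo; exact: cf.
  - have [_ Fa Fb] := (continuous_within_itvP _ (e3 n)).1 cFn.
    by split=> [x /sub xab||//]; [have [] := dF xab|exact: Fa].
  - by move=> x /sub xab; rewrite derive1E (derive_val (is_derive := dF xab)).
apply/integrableP; split; first by apply/measurable_EFinP; exact: mfab.
rewrite integral_itv_bndoo; last first.
  by apply/measurable_EFinP; apply: measurableT_comp.
rewrite -EU (@le_lt_trans _ _ (F b - F a)%:E) ?ltry//.
have : (\int[mu]_(x in E n) `|(f x)%:E| @[n --> \oo] -->
   \int[mu]_(x in \bigcup_i E i) `|(f x)%:E|)%E.
  apply: ge0_nondecreasing_set_cvg_integral => //.
  - apply/nondecreasing_seqP => n; apply/subsetPset.
    apply: subset_itv; rewrite bnd_simp; first by rewrite lerD2l eS.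
    by rewrite lerD2l lerN2 eS.
  - move=> n; apply: measurableT_comp => //; apply/measurable_EFinP.
    by apply: (measurable_funS _ (@E_oo n)).
move=> cE; rewrite -(cvg_lim _ cE)//; apply: lime_le.
  exact: cvgP cE.
apply: nearW => n; rewrite (le_trans _ (intE n))//.
rewrite le_eqVlt; apply/orP; left; apply/eqP; apply: eq_integral => x.
by rewrite inE => /E_oo xab; rewrite /= ger0_norm// f0.
Qed.

(** [f] may be unbounded at the ends, so [F] is compared with the integral function [G]: [F - G] is
    continuous up to the ends with zero derivative inside, and the mean value theorem equates its
    end values. *)
Lemma integrable_FTC : mu.-integrable `[a, b] (EFin \o f) ->
  \int[mu]_(x in `[a, b]) f x = F b - F a.
Proof.
move=> intf.
pose G x := parameterized_integral mu a x f.
have cG : {within `[a, b], continuous G}.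
  exact: parameterized_integral_continuous (ltW ab) intf.
have dG x : x \in `]a, b[%R -> is_derive x 1 G (f x).
  move=> xab; have /andP[ax xb] : a < x < b by rewrite in_itv in xab.
  have [dG <-] := @continuous_FTC1_closed R f a x b xb intf ax (cf xab).
  by rewrite derive1E; exact/derivableP.
have cFG : {within `[a, b], continuous (F - G)}.
  by move=> x; apply: continuousD _; [exact: cF|exact/continuousN/cG].
have [|c cab] := @MVT R (F - G) (cst 0) a b ab _ cFG.
  move=> x xab; rewrite -(subrr (f x)).
  exact: is_deriveB (dF xab) (dG _ xab).
have Ga : G a = 0 by rewrite /G /parameterized_integral set_itv1 Rintegral_set1.
have -> : \int[mu]_(x in `[a, b]) f x = G b by [].
by rewrite mul0r -![(F - G) _]/(_ - _) Ga => E; lra.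
Qed.

End ImproperFTC.

(** * Powers of x and 1 - x near the endpoints *)

Section BetaIntegrands.
Variables (R : realType).
Local Notation mu := (@lebesgue_measure R).

Lemma powR_continuous_gt0 (a x : R) : 0 < x ->
  {for x, continuous (fun y : R => y `^ a)}.
Proof.
move=> x0; apply/differentiable_continuous/derivable1_diffP.
by have [] := is_derive1_powR a x0.
Qed.

Lemma is_derive_expRN (c x : R) :
  is_derive x 1 (fun y => expR (- (c * y))) (- c * expR (- (c * x))).
Proof.
have dc : is_derive x 1 (fun y : R => - (c * y)) (- c).
  have -> : (fun y : R => - (c * y)) = (- c) \*: id.
    by apply/funext => y; rewrite /= /GRing.scale /= mulNr.
  apply: (is_derive_eq (is_deriveZ _ (is_derive_id x 1))).
  by rewrite /GRing.scale /= mulr1.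
have := @is_derive1_comp R expR (fun y => - (c * y)) x _ _
  (is_derive_expR _) dc.
by move/is_derive_eq; apply; rewrite mulrC.
Qed.

Lemma is_derive_onem (x : R) : is_derive x 1 (fun y : R => 1 - y) (-1).
Proof.
by rewrite -[X in is_derive _ _ _ X]sub0r; exact: is_deriveB.
Qed.

Lemma is_derive_powR_onem (b x : R) : x < 1 ->
  is_derive x 1 (fun y => (1 - y) `^ b) (- (b * (1 - x) `^ (b - 1))).
Proof.
move=> x1; have x1' : 0 < 1 - x by rewrite subr_gt0.
have := @is_derive1_comp R (fun y => y `^ b) (fun y => 1 - y) x _ _
  (is_derive1_powR b x1') (is_derive_onem x).
by move/is_derive_eq; apply; rewrite mulrN1.
Qed.

Lemma powR_onem_continuous (b x : R) : x < 1 ->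
  {for x, continuous (fun y : R => (1 - y) `^ b)}.
Proof.
move=> x1; apply/differentiable_continuous/derivable1_diffP.
by have [] := is_derive_powR_onem b x1.
Qed.

Lemma powR_within01 (a : R) : 0 < a ->
  {within `[0, 1], continuous (fun x => x `^ a : R)}.
Proof.
move=> a0; apply/continuous_within_itvP => //; split.
- by move=> x; rewrite in_itv /= => /andP[x0 _]; exact: powR_continuous_gt0.
- by rewrite powR0 ?gt_eqF//; exact: powR_cvg0.
- exact/cvg_at_left_filter/powR_continuous_gt0.
Qed.

Lemma powR_onem_within01 (b : R) : 0 < b ->
  {within `[0, 1], continuous (fun y : R => (1 - y) `^ b)}.
Proof.
move=> b0; apply/continuous_within_itvP => //; split.
- by move=> x; rewrite in_itv /= => /andP[_ x1]; exact: powR_onem_continuous.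
- exact/cvg_at_right_filter/powR_onem_continuous.
- rewrite subrr powR0 ?gt_eqF//.
  apply: (@cvg_comp _ _ _ (fun x : R => 1 - x) (fun x => x `^ b) _ (0^'+));
    last exact: powR_cvg0.
  move=> A [e e0 eA]; exists e => // y /= ye y1; apply: eA => /=.
    by rewrite sub0r normrN.
  by rewrite subr_gt0.
Qed.

(** Up to the factor a, the integrand is the nonnegative derivative of x^a, which is continuous at 0
    even where that derivative blows up. *)
Lemma integrable_powR_div (a : R) : 0 < a ->
  mu.-integrable `[0, 1] (EFin \o (fun x => x `^ a / x)).
Proof.
move=> a0.
have : mu.-integrable `[0, 1] (EFin \o (fun x => a * (x `^ a / x))).
  apply: (derive_ge0_integrable ltr01 _ _ (powR_within01 a0)) => x.
  - rewrite in_itv /= => /andP[x0 _].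
    apply: (is_derive_eq (is_derive1_powR a x0)).
    by rewrite -(mulr_powRB1 (ltW x0) a0) mulrAC mulfV ?gt_eqF// mul1r.
  - rewrite in_itv /= => /andP[x0 _]; apply: cvgM; first exact: cvg_cst.
    apply: cvgM; first exact: powR_continuous_gt0.
    by apply: cvgV; rewrite ?gt_eqF.
  - rewrite in_itv /= => /andP[x0 _].
    by rewrite mulr_ge0 ?divr_ge0 ?powR_ge0 ?ltW.
move=> ia; have : mu.-integrable `[0, 1]
    (fun x => a^-1%:E * (a * (x `^ a / x))%:E)%E.
  exact: integrableZl.
apply: eq_integrable; first exact: measurable_itv.
by move=> x _ /=; rewrite -EFinM mulKf ?gt_eqF.
Qed.

Lemma integrable_powR_onem_div (b : R) : 0 < b ->
  mu.-integrable `[0, 1] (EFin \o (fun x => (1 - x) `^ b / (1 - x))).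
Proof.
move=> b0.
have : mu.-integrable `[0, 1] (EFin \o (fun x => b * ((1 - x) `^ b / (1 - x)))).
  (* The primitive is negated because (1 - x)^b decreases. *)
  apply: (@derive_ge0_integrable _ (fun x => - (1 - x) `^ b) _ _ _ ltr01) => x.
  - rewrite in_itv /= => /andP[_ x1].
    have x1' : 0 < 1 - x by rewrite subr_gt0.
    apply: (is_derive_eq (is_deriveN (is_derive_powR_onem b x1))).
    rewrite opprK -(mulr_powRB1 (ltW x1') b0) mulrAC mulfV ?gt_eqF//.
    by rewrite mul1r.
  - rewrite in_itv /= => /andP[_ x1].
    apply: cvgM; first exact: cvg_cst.
    apply: cvgM; first exact: powR_onem_continuous.
    apply: cvgV; first by rewrite gt_eqF ?subr_gt0.
    by apply: cvgB; [exact: cvg_cst|].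
  - by apply: cvgN; exact: powR_onem_within01.
  - rewrite in_itv /= => /andP[_ x1].
    by rewrite mulr_ge0 ?divr_ge0 ?powR_ge0 ?subr_ge0 ?ltW.
move=> ib; have : mu.-integrable `[0, 1]
    (fun x => b^-1%:E * (b * ((1 - x) `^ b / (1 - x)))%:E)%E.
  exact: integrableZl.
apply: eq_integrable; first exact: measurable_itv.
by move=> x _ /=; rewrite -EFinM mulKf ?gt_eqF.
Qed.

End BetaIntegrands.

(** * The Jacobi functional *)

Section JacobiFunctional.
Variables (R : realType) (alpha beta : R).
Hypotheses (alpha_gt0 : 0 < alpha) (beta_gt0 : 0 < beta).
Local Notation mu := (@lebesgue_measure R).

(** [betaw] vanishes at 0 and 1 because the inverse of 0 is 0; as the weight
    vanishes there too, [w = x (1 - x) betaw(x) e^(- lambda x)] on all of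
    [[0, 1]]. *)
Definition betaw (x : R) : R := x `^ alpha / x * ((1 - x) `^ beta / (1 - x)).

Lemma betaw_ge0 x : x \in `[0, 1]%R -> 0 <= betaw x.
Proof.
rewrite in_itv /= => /andP[x0 x1].
by rewrite mulr_ge0 ?divr_ge0 ?powR_ge0 ?subr_ge0.
Qed.

(** Domination by the sum of the two one-ended singularities, from 1 / (x (1 - x)) = 1 / x + 1 / (1
    - x) and powers at most 1 on [0, 1]. *)
Lemma integrable_betaw : mu.-integrable `[0, 1] (EFin \o betaw).
Proof.
have ia := integrable_powR_div alpha_gt0.
have ib := integrable_powR_onem_div beta_gt0.
have /measurable_EFinP ma := measurable_int _ ia.
have /measurable_EFinP mb := measurable_int _ ib.
have iab : mu.-integrable `[0, 1]
    (fun x => (x `^ alpha / x)%:E + ((1 - x) `^ beta / (1 - x))%:E)%E.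
  exact: integrableD.
apply: le_integrable iab => //.
  by apply/measurable_EFinP; exact: measurable_funM.
move=> x /= x01; rewrite lee_fin.
have := x01; rewrite in_itv /= => /andP[x0 x1].
rewrite !ger0_norm ?betaw_ge0 ?addr_ge0 ?divr_ge0 ?powR_ge0 ?subr_ge0//.
rewrite /betaw; have [->|xn0] := eqVneq x 0.
  by rewrite invr0 !(mulr0, mul0r) add0r subr0 powR1 divr1.
have [->|xn1] := eqVneq x 1.
  by rewrite subrr invr0 !mulr0 addr0 powR1 divr1.
have px : 0 < x by rewrite lt_neqAle eq_sym xn0.
have p1x : 0 < 1 - x by rewrite subr_gt0 lt_neqAle xn1.
have a1 : x `^ alpha <= 1 `^ alpha by rewrite ge0_ler_powR ?nnegrE// ltW.
have b1 : (1 - x) `^ beta <= 1 `^ beta.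
  by rewrite ge0_ler_powR ?nnegrE// ?(ltW beta_gt0) ?(ltW p1x)// lerBlDr lerDl.
rewrite powR1 in a1 b1.
have a0 := powR_ge0 x alpha; have b0 := powR_ge0 (1 - x) beta.
rewrite [leLHS](_ : _ = x `^ alpha * (1 - x) `^ beta / x +
    x `^ alpha * (1 - x) `^ beta / (1 - x)).
  by rewrite lerD// ler_pM2r ?invr_gt0// ?ler_piMr// ler_piMl.
by field; rewrite gt_eqF// gt_eqF.
Qed.

Lemma integrable_continuous_betaw (h : R -> R) : continuous h ->
  mu.-integrable `[0, 1] (EFin \o (fun x => h x * betaw x)).
Proof.
move=> ch.
suff : mu.-integrable `[0, 1] ((EFin \o h) \* (EFin \o betaw))%E by [].
apply: integrableMr => //; last exact: integrable_betaw.
  exact: measurable_funS (continuous_measurable_fun ch).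
have : compact (h @` `[0, 1]).
  apply: continuous_compact; last exact: segment_compact.
  exact: continuous_subspaceT.
move=> /compact_bounded [K [Kr hK]]; exists K; split => // y /hK {}hK x x01.
by apply: hK; exists x.
Qed.

(** The regular factor of the integrand; the endpoint singularities all sit in [betaw]. *)
Definition pexp (l : R) (p : {poly R}) (x : R) := p.[x] * expR (- (l * x)).

Lemma continuous_pexp l p : continuous (pexp l p).
Proof.
move=> x; apply: cvgM; first exact: continuous_horner.
apply: (@continuous_comp _ _ _ (fun x => - (l * x)) expR);
  last exact: continuous_expR.
by apply: cvgN; apply: cvgM => //; exact: cvg_cst.
Qed.

(** The concrete M, with density w / (x (1 - x)). *)
Definition jacobi (l : R) (p : {poly R}) : R :=
  \int[mu]_(x in `[0, 1]) (pexp l p x * betaw x).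

Lemma integrable_pexp l p :
  mu.-integrable `[0, 1] (EFin \o (fun x => pexp l p x * betaw x)).
Proof. exact/integrable_continuous_betaw/continuous_pexp. Qed.

Lemma jacobi_is_scalar l : scalar (jacobi l).
Proof.
move=> c p q.
have -> : jacobi l (c *: p + q) = jacobi l (c *: p) + jacobi l q.
  rewrite /jacobi -RintegralD//; [|exact: integrable_pexp..].
  by apply: eq_Rintegral => x _; rewrite /pexp hornerD !mulrDl.
congr (_ + _); rewrite /jacobi -RintegralZl//; last exact: integrable_pexp.
by apply: eq_Rintegral => x _; rewrite /pexp hornerZ !mulrA.
Qed.

HB.instance Definition _ l := GRing.isLinear.Build R {poly R} R *%R (jacobi l)
  (jacobi_is_scalar l).

Definition jacobi_scalar l : {scalar {poly R}} := jacobi l.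

Lemma wint_horner l (q : {poly R}) :
  wint alpha beta l (horner q) = jacobi l ('X * (1 - 'X) * q).
Proof.
apply: eq_Rintegral => x _; rewrite /weight /pexp /betaw.
rewrite !(hornerM, hornerD, hornerN, hornerX, hornerC).
(* Inverses cancel only for x and 1 - x nonzero; at the endpoints both sides are 0 as alpha and beta
   are positive. *)
have [->|x0] := eqVneq x 0; first by rewrite powR0 ?gt_eqF// !(mul0r, mulr0).
have [->|x1] := eqVneq (1 - x) 0.
  by rewrite powR0 ?gt_eqF// !(mul0r, mulr0).
by field; rewrite x0 x1.
Qed.

Lemma wint_horner_div l (q : {poly R}) :
  wint alpha beta l (fun x => q.[x] / x) = jacobi l ((1 - 'X) * q).
Proof.
apply: eq_Rintegral => x _; rewrite /weight /pexp /betaw.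
rewrite !(hornerM, hornerD, hornerN, hornerX, hornerC).
have [->|x0] := eqVneq x 0; first by rewrite invr0 !(mul0r, mulr0).
have [->|x1] := eqVneq (1 - x) 0.
  by rewrite powR0 ?gt_eqF// !(mul0r, mulr0).
by field; rewrite x0 x1.
Qed.

Lemma is_derive_jacobi (l : R) (p : {poly R}) :
  is_derive l 1 (fun t => jacobi t p) (- jacobi l ('X * p)).
Proof.
pose f (t x : R) := pexp t p x * betaw x.
have df (t x : R) : is_derive t 1 (f ^~ x) (- (pexp t ('X * p) x * betaw x)).
  have -> : f ^~ x = (p.[x] * betaw x) \*: (fun s => expR (- (x * s))).
    apply/funext => s.
    by rewrite /f /pexp /= /GRing.scale /= mulrAC (mulrC s).
  apply: (is_derive_eq (is_deriveZ _ (is_derive_expRN x t))); rewrite (mulrC x).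
  by rewrite /pexp hornerM hornerX /GRing.scale /=; ring.
have dfE (t x : R) : partial1of2 f t x = - (pexp t ('X * p) x * betaw x).
  by rewrite partial1of2E (derive_val (is_derive := df t x)).
(* A bound uniform for t within 1 of l: there e^(- t x) is at most e^(|l| + 1) for x in [0, 1]. *)
pose h x := `|('X * p).[x]| * expR (`|l| + 1).
pose G x := h x * `|betaw x|.
have intG : mu.-integrable `[0, 1] (EFin \o G).
  have : mu.-integrable `[0, 1] (EFin \o (fun x => h x * betaw x)).
    apply: integrable_continuous_betaw => x; apply: cvgM; last exact: cvg_cst.
    by apply: cvg_norm; exact: continuous_horner.
  apply: eq_integrable => // x; rewrite inE /= => /betaw_ge0 b0.
  by rewrite /G ger0_norm.
have G0 x : 0 <= G x by rewrite !mulr_ge0 ?expR_ge0.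
pose I : set R := `]l - 1, l + 1[.
have lI : I l by rewrite /I /= in_itv /= ltrBlDr ltrDl ltr01.
have intf (t : R) : I t -> mu.-integrable `[0, 1] (EFin \o f t).
  by move=> _; exact: integrable_pexp.
have derf (t x : R) : I t -> (`[0, 1] : set R) x -> derivable (f ^~ x) t 1.
  by move=> _ _; have [] := df t x.
have Gub (t x : R) : I t -> (`[0, 1] : set R) x ->
    `|partial1of2 f t x| <= G x.
  rewrite /I /= !in_itv /= => /andP[t1 t2] /andP[x0 x1].
  rewrite dfE normrN normrM /G ler_wpM2r// /pexp normrM /h ler_wpM2l//.
  rewrite ger0_norm ?expR_ge0// ler_expR.
  rewrite (le_trans (ler_norm _))// normrN normrM (ger0_norm x0).
  rewrite (le_trans (ler_piMr _ x1))// ler_norml.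
  have := ler_norm l; have := ler_norm (- l); rewrite normrN.
  by move: t1 t2; lra.
have d : derivable (fun t => jacobi t p) l 1.
  exact: (derivable_under_integral _ lI intf derf G0 intG Gub).
have dE : (fun t => jacobi t p)^`() l =
    \int[mu]_(x in `[0, 1]) partial1of2 f l x.
  exact: (differentiation_under_integral _ lI intf derf G0 intG Gub).
apply: DeriveDef; first exact: d.
rewrite -derive1E dE -mulN1r -[RHS](scalarZ (jacobi l)) /jacobi.
apply: eq_Rintegral => x _; rewrite dfE /pexp hornerZ; ring.
Qed.

Lemma finite_roots (p : {poly R}) : p != 0 -> finite_set [set x | root p x].
Proof.
move=> p0; apply: contrapT => /(infinite_set_fset (size p)) [B Br].
rewrite leqNgt => /negP; apply.
apply: max_poly_roots => //.
  by apply/allP => x xB; apply: Br.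
exact: finmap.fset_uniq.
Qed.

(** Were the integral 0, the integrand would vanish almost everywhere. As the density is positive
    inside, ]0, 1[ would be covered by a null set and the finitely many roots of [p], against its
    measure 1. *)
Lemma jacobi_gt0 (l : R) : pos_functional (jacobi l).
Proof.
move=> p p0 pge0; have fge0 x : `[0, 1] x -> 0 <= pexp l p x * betaw x.
  move=> x01; rewrite mulr_ge0 ?betaw_ge0// /pexp mulr_ge0 ?expR_ge0//.
  exact: pge0.
rewrite lt_neqAle Rintegral_ge0// andbT eq_sym; apply/eqP => J0.
have intp := integrable_pexp l p.
have : (\int[mu]_(x in `[0%R, 1%R]) `|(pexp l p x * betaw x)%:E| = 0)%E.
  transitivity (\int[mu]_(x in `[0%R, 1%R]) (pexp l p x * betaw x)%:E)%E.
    by apply: eq_integral => x; rewrite inE => x01; rewrite /= ger0_norm ?fge0.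
  rewrite -[LHS]fineK; last exact: integrable_fin_num.
  by congr (_%:E); exact: J0.
move/ae_eq_integral_abs => /(_ (measurable_itv _) (measurable_int _ intp)).
move=> [N [mN N0 sub]].
have cZ : countable [set x | root p x].
  by apply: finite_set_countable; exact: finite_roots.
have mZ : measurable ([set x | root p x] : set (measurableTypeR R)).
  exact: countable_measurable.
have : (mu `]0%R, 1%R[ <= mu N + mu [set x | root p x])%E.
  apply: le_trans (measureU2 _ mN mZ); apply: le_measure; rewrite ?inE//.
    exact: measurableU.
  move=> x x01; have [rx|nrx] := boolP (root p x); [by right|left].
  apply: sub => /= /(_ (subset_itv_oo_cc x01)) [].
  have /andP[x0 x1] : 0 < x < 1 by move: x01; rewrite /= in_itv.
  have px0 : p.[x] != 0 := nrx.
  apply/eqP; rewrite /pexp /betaw !mulf_neq0//;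
    by rewrite gt_eqF// ?invr_gt0 ?expR_gt0 ?powR_gt0 ?subr_gt0.
rewrite [X in (_ <= X + _)%E]N0 add0e.
rewrite [X in (_ <= X)%E]countable_lebesgue_measure0//.
by rewrite lebesgue_measure_itv/= lte_fin ltr01 oppr0 adde0 lee_fin ler10.
Qed.

Lemma jacobi_pearson (l : R) : pearson alpha beta l (jacobi l).
Proof.
move=> p.
(* [q] is chosen so that its integrand is the derivative of p w, which vanishes at both ends since
   alpha and beta are positive. *)
pose q := 'X * (1 - 'X) * p^`() + alpha *: ((1 - 'X) * p)
  - beta *: ('X * p) - l *: ('X * (1 - 'X) * p).
transitivity (jacobi l q); first by rewrite !linearB linearD !scalarZ.
pose F (x : R) := p.[x] * expR (- (l * x)) * (x `^ alpha * (1 - x) `^ beta).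
have <- : F 1 - F 0 = 0.
  by rewrite /F subrr !powR0 ?gt_eqF// !(mul0r, mulr0) subrr.
apply: integrable_FTC => //; last exact: integrable_pexp.
- move=> x; rewrite in_itv /= => /andP[x0 x1].
  have x1' : 0 < 1 - x by rewrite subr_gt0.
  apply: (is_derive_eq (is_deriveM
    (is_deriveM (is_derive_poly p x) (is_derive_expRN l x))
    (is_deriveM (is_derive1_powR alpha x0) (is_derive_powR_onem beta x1)))).
  rewrite !fctE /pexp /betaw /q /GRing.scale /=.
  rewrite !(hornerD, hornerN, hornerZ, hornerM, hornerX, hornerC).
  rewrite -(mulr_powRB1 (ltW x0) alpha_gt0) -(mulr_powRB1 (ltW x1') beta_gt0).
  by field; rewrite !gt_eqF.
- move=> x; rewrite in_itv /= => /andP[x0 x1]; apply: cvgM.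
    exact: continuous_pexp.
  apply: cvgM; apply: cvgM.
  + exact: powR_continuous_gt0.
  + by apply: cvgV; rewrite ?gt_eqF.
  + exact: powR_onem_continuous.
  + apply: cvgV; first by rewrite gt_eqF ?subr_gt0.
    by apply: cvgB; [exact: cvg_cst|].
- move=> x; apply: cvgM.
    by apply: continuous_subspaceT x => x; exact: continuous_pexp.
  apply: cvgM; first exact: powR_within01.
  exact: powR_onem_within01.
Qed.

End JacobiFunctional.

(** * Elimination and the Riccati equations *)

Lemma monic_orthogonal_ops (R : realType) (alpha beta l : R)
    (P : nat -> {poly R}) : 0 < alpha -> 0 < beta ->
  monic_orthogonal alpha beta l P -> orthogonal_system (jacobi alpha beta l) P.
Proof.
move=> a0 b0 [mP oP]; split=> [|n|n|m n mn]; first exact: jacobi_gt0.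
- by have [] := mP n.
- by have [] := mP n.
- rewrite -wint_horner// -[RHS](oP m n mn).
  by congr wint; apply/funext => x; rewrite hornerM.
Qed.

(** Derivability is asserted separately because [derive1] has a value even where the derivative does
    not exist. *)
Theorem theorem2p4 (R : realType) (alpha beta : R)
    (alpha_gt0 : 0 < alpha) (beta_gt0 : 0 < beta)
    (P : R -> nat -> {poly R})
    (P_orth : forall l : R, monic_orthogonal alpha beta l (P l))
    (n : nat) (lambda : R) (lambda_neq0 : lambda != 0) :
  let Rn := aux_R alpha beta P n in
  let rn := aux_r alpha beta P n in
  [/\ derivable Rn lambda 1,
      derivable rn lambda 1,
      lambda * derive1 Rn lambda =
        - (alpha * lambda)
        + Rn lambda * (2 * n%:R + 1 + alpha + beta + lambda)
        - Rn lambda ^+ 2 + 2 * lambda * rn lambda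
    & derive1 rn lambda =
        Rn lambda / (lambda * Rn lambda - lambda ^+ 2) *
          (n%:R * (n%:R + beta) + (2 * n%:R + alpha + beta) * rn lambda
           + lambda / Rn lambda * (rn lambda ^+ 2 - alpha * rn lambda))
        + (rn lambda ^+ 2 - alpha * rn lambda) / Rn lambda].
Proof.
move=> Rn rn.
pose M := jacobi_scalar alpha_gt0 beta_gt0.
have ME l p : M l p = jacobi alpha beta l p by [].
have ops l : orthogonal_system (M l) (P l) by exact: monic_orthogonal_ops.
have dM (l : R) (p : {poly R}) :
    is_derive l 1 (fun t => M t p) (- M l ('X * p)).
  exact: is_derive_jacobi.
pose h l k := M l ('X * (1 - 'X) * P l k ^+ 2).
have hE l k : sqnorm alpha beta l (P l) k = h l k.
  rewrite /h ME -wint_horner//.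
  by congr wint; apply/funext => x; rewrite horner_exp.
pose ra l k := M l ('X * (1 - 'X) * ('X * P l k ^+ 2)) / h l k.
pose rR l k := alpha / h l k * M l ((1 - 'X) * P l k ^+ 2).
pose rr l k := alpha / h l k * M l ((1 - 'X) * (P l k.+1 * P l k)).
have RE k : aux_R alpha beta P k = rR^~ k.
  apply/funext => l; rewrite /aux_R hE /rR ME -wint_horner_div//.
  by congr (_ * wint _ _ _ _); apply/funext => x; rewrite horner_exp.
have rE k : aux_r alpha beta P k.+1 = rr^~ k.
  apply/funext => l; rewrite /= hE /rr ME -wint_horner_div//.
  by congr (_ * wint _ _ _ _); apply/funext => x; rewrite hornerM.
have pea := jacobi_pearson alpha_gt0 beta_gt0 lambda.
have R0 : rR lambda n != 0 by rewrite gt_eqF//; exact: (auxR_gt0 (ops lambda)).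
have Rl : rR lambda n - lambda != 0.
  by rewrite gt_eqF// subr_gt0; exact: (auxR_gt (ops lambda) beta_gt0 pea).
have la := lambda_recur (ops lambda) pea n.
rewrite -/(h lambda n) -/(ra lambda n) -/(rR lambda n) in la.
rewrite {}/Rn {}/rn RE.
(* For n = 0 the convention r_0 = 0 makes both sides of the second equation vanish. *)
case: n => [|n] in R0 Rl la *.
  have dR : is_derive lambda 1 (rR^~ 0%N) (- alpha + ra lambda 0 * rR lambda 0).
    exact: (is_derive_auxR0 dM ops alpha lambda).
  split; [by have [] := dR|exact: derivable_cst| |].
    rewrite derive1E (derive_val (is_derive := dR)) /=.
    have -> : lambda * (- alpha + ra lambda 0 * rR lambda 0) =
      lambda * ra lambda 0 * rR lambda 0 - alpha * lambda by ring.
    by rewrite la; ring.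
  by rewrite derive1_cst /= !(mul0r, mulr0, subr0, expr0n, addr0).
rewrite rE.
pose bt := h lambda n.+1 / h lambda n.
have dR : is_derive lambda 1 (rR^~ n.+1)
    (2 * rr lambda n - alpha + ra lambda n.+1 * rR lambda n.+1).
  exact: (is_derive_auxRS dM ops alpha lambda n).
have dr : is_derive lambda 1 (rr^~ n) (bt * (rR lambda n - rR lambda n.+1)).
  exact: (is_derive_auxr dM ops alpha lambda n).
split; [by have [] := dR|by have [] := dr| |].
  rewrite derive1E (derive_val (is_derive := dR)).
  have -> : lambda * (2 * rr lambda n - alpha + ra lambda n.+1 * rR lambda n.+1)
      = lambda * ra lambda n.+1 * rR lambda n.+1
        + (2 * rr lambda n - alpha) * lambda by ring.
  by rewrite la; ring.
rewrite derive1E (derive_val (is_derive := dr)).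
have E1 : rr lambda n * (rr lambda n - alpha) =
    bt * rR lambda n.+1 * rR lambda n.
  exact: (auxrM (ops lambda) alpha n).
have E2 : (n.+1%:R + rr lambda n) * (n.+1%:R + rr lambda n + beta) =
    bt * (rR lambda n.+1 - lambda) * (rR lambda n - lambda).
  exact: (auxr_addM (ops lambda) pea n).
clear dr; clearbody bt.
move: (rr lambda n) (rR lambda n) (rR lambda n.+1) (n.+1%:R : R) bt E1 E2 R0 Rl.
move=> r R1 R2 N bt E1 E2 R20 R2l.
have -> : r ^+ 2 - alpha * r = bt * R2 * R1 by rewrite -E1; ring.
(* This is the difference of [E2] and [E1]. The bracket of the second equation becomes - lambda bt
   (R2 - lambda), so the first summand reduces to - bt R2 and the last one is bt R1. *)
have -> : N * (N + beta) + (2 * N + alpha + beta) * r =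
    bt * (R2 - lambda) * (R1 - lambda) - bt * R2 * R1.
  by rewrite -E1 -E2; ring.
have -> : lambda * R2 - lambda ^+ 2 = lambda * (R2 - lambda) by ring.
by field; rewrite R20 R2l lambda_neq0.
Qed.
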